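(* Let $G$ be a graph of order $n$ with minimum degree $\delta$, and let $k$ be an integer with $0<k<n$. Suppose $n\geq \max\{6\delta+5k+1,\ 5\delta+k^2+4k+1\}$. If $$\rho(G)\geq \rho\big(K_{\delta}\vee (K_{n-2\delta-k}+(\delta+k)K_1)\big),$$ then $\mu_f(G)>\frac{n-k}{2}$ unless $G\cong K_{\delta}\vee (K_{n-2\delta-k}+(\delta+k)K_1)$.
   Context: All graphs are finite, simple and undirected. $\rho(G)$ denotes the spectral radius of $G$, i.e. the largest eigenvalue of its adjacency matrix. A fractional matching of $G$ is a function $f:E(G)\to[0,1]$ such that for every vertex $v$, $\sum_{e\ni v} f(e)\leq 1$ (sum over edges incident with $v$). The fractional matching number is $\mu_f(G)=\max\{\sum_{e\in E(G)}f(e): f \text{ a fractional matching of } G\}$. $K_m$ is the complete graph on $m$ vertices, $mK_1$ is the edgeless graph on $m$ vertices, $G_1+G_2$ denotes the disjoint union of $G_1$ and $G_2$, and $G_1\vee G_2$ (the join) is obtained from $G_1+G_2$ by adding all edges between $V(G_1)$ and $V(G_2)$. *)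

(* Defs.v *)
From mathcomp Require Import all_boot all_order all_algebra.
From mathcomp Require Import boolp classical_sets reals.

Set Implicit Arguments.
Unset Strict Implicit.
Unset Printing Implicit Defensive.

Import Order.TTheory GRing.Theory Num.Theory.

Record sgraph := SGraph {
  vertex :> finType;
  adj : rel vertex;
  adj_sym : symmetric adj;
  adj_irr : irreflexive adj }.

Definition graph_iso (G H : sgraph) : Prop :=
  exists2 f : G -> H, bijective f & forall x y, adj (f x) (f y) = adj x y.

Section CompleteGraph.
Variable m : nat.
Definition complete_rel : rel 'I_m := fun x y => x != y.
Fact complete_sym : symmetric complete_rel.
Proof. by move=> x y; rewrite /complete_rel eq_sym. Qed.
Fact complete_irr : irreflexive complete_rel.
Proof. by move=> x; rewrite /complete_rel eqxx. Qed.
Definition complete_graph := SGraph complete_sym complete_irr.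
End CompleteGraph.

Section EdgelessGraph.
Variable m : nat.
Definition edgeless_rel : rel 'I_m := fun _ _ => false.
Fact edgeless_sym : symmetric edgeless_rel. Proof. by []. Qed.
Fact edgeless_irr : irreflexive edgeless_rel. Proof. by []. Qed.
Definition edgeless_graph := SGraph edgeless_sym edgeless_irr.
End EdgelessGraph.

Section UnionJoin.
Variables G H : sgraph.

Definition union_rel : rel (G + H)%type := fun u v =>
  match u, v with
  | inl x, inl y => adj x y
  | inr x, inr y => adj x y
  | _, _ => false
  end.
Fact union_sym : symmetric union_rel.
Proof. by case=> x [] y //=; rewrite adj_sym. Qed.
Fact union_irr : irreflexive union_rel.
Proof. by case=> x /=; rewrite adj_irr. Qed.
Definition disjoint_union := SGraph union_sym union_irr.

Definition join_rel : rel (G + H)%type := fun u v =>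
  match u, v with
  | inl x, inl y => adj x y
  | inr x, inr y => adj x y
  | _, _ => true
  end.
Fact join_sym : symmetric join_rel.
Proof. by case=> x [] y //=; rewrite adj_sym. Qed.
Fact join_irr : irreflexive join_rel.
Proof. by case=> x /=; rewrite adj_irr. Qed.
Definition graph_join := SGraph join_sym join_irr.
End UnionJoin.

(* The natural-number subtraction is truncated, so the graph has order [n]
   only when [2 * delta + k <= n]. *)
Definition extremal_graph (n delta k : nat) : sgraph :=
  graph_join (complete_graph delta)
    (disjoint_union (complete_graph (n - 2 * delta - k))
                    (edgeless_graph (delta + k))).

Section GraphParameters.
Variable G : sgraph.

Definition degree (v : G) : nat := #|[set w | adj v w]|.

(* Every degree is smaller than [#|G|], so the initial value of the minimum is
   only reached when [G] has no vertex. *)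
Definition min_degree : nat := \big[minn/#|G|]_(v : G) degree v.

Definition edges : {set {set G}} :=
  [set [set p.1; p.2] | p : G * G & adj p.1 p.2].

Local Open Scope ring_scope.
Local Open Scope classical_set_scope.

Variable R : realType.

Definition adjacency_matrix : 'M[R]_#|G| :=
  \matrix_(i, j) (adj (enum_val i) (enum_val j))%:R.

(* For a graph with at least one vertex the set of eigenvalues is finite, and
   nonempty because the matrix is real symmetric, so [sup] is its maximum. *)
Definition spectral_radius : R := sup [set a | eigenvalue adjacency_matrix a].

(* Only the values of [f] on the edges of [G] matter. *)
Definition fractional_matching (f : {set G} -> R) : Prop :=
  (forall e, e \in edges -> 0 <= f e <= 1) /\
  (forall v, \sum_(e in edges | v \in e) f e <= 1).

(* The values form the image of a compact polytope containing 0 under a linear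
   form, so [sup] is a maximum. *)
Definition fractional_matching_number : R :=
  sup [set \sum_(e in edges) f e | f in fractional_matching].

End GraphParameters.

Arguments adjacency_matrix : clear implicits.
Arguments spectral_radius : clear implicits.
Arguments fractional_matching_number : clear implicits.

(* Main.v *)
(** If [mu_f(G) <= (n - k)/2], Hall's theorem on the bipartite double cover
    gives a set [S] of some size [s >= delta] and an independent set of size
    [s + k] all of whose neighbours lie in [S], so that [G] is a spanning
    subgraph of [H_s = K_s \/ (K_{n-2s-k} + (s+k) K_1)].  The spectral radius of
    [H_s] is the largest root of an explicit cubic [phi_s].  With [r] a root of
    [phi_delta] that is at least [n - delta - k - 1], one has
    [phi_s(r) = (s - delta) Q(r)] with [Q(r) > 0]; hence a suitable positive
    vector [y], constant on the vertex classes of [H_s], satisfies [A_G y <= r y].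
    Since [rho(G) >= r], equality must hold on the support of an eigenvector,
    and this forces [s = delta] and [G = H_delta]. *)
Require Import Defs.
From mathcomp Require Import all_boot all_order all_algebra.
From mathcomp Require Import boolp classical_sets reals.
From mathcomp Require Import zify ring lra.
Import Order.TTheory GRing.Theory Num.Theory.
Local Open Scope ring_scope.

(** * Hall's theorem with deficiency *)

(** Rado's argument: while some [N x] has two elements, one of them can be deleted without breaking
    the Hall condition. Once every [N x] has at most one element, the union of all [N x] serves as
    [B]. *)
Lemma hall_deficiency (T U : finType) (x0 : T) (d : nat) (N : T -> {set U}) :
    (forall A : {set T}, #|A| <= #|\bigcup_(x in A) N x| + d)%N ->
  exists (B : {set U}) (g : U -> T),
    [/\ {in B &, injective g}, forall u, u \in B -> u \in N (g u)
      & (#|T| <= #|B| + d)%N].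
Proof.
have [m] := ubnP (\sum_x #|N x|)%N; elim: m N => // m IH N lt_m hN.
have [/existsP[x] | /existsPn small] := boolP [exists x, 1 < #|N x|]%N; last first.
  have NP u : u \in \bigcup_(x in [set: T]) N x ->
      u \in N (odflt x0 [pick x | u \in N x]).
    case/bigcupP => x _ ux; case: pickP => [//|/(_ x)]; by rewrite ux.
  exists (\bigcup_(x in [set: T]) N x), (fun u => odflt x0 [pick x | u \in N x]).
  split => [u v /NP uB /NP vB eg||]; last by rewrite -cardsT; exact: hN.
  - rewrite eg in uB; have := small (odflt x0 [pick x | v \in N x]).
    by rewrite -leqNgt => /card_le1P /(_ _ uB) /(_ v); rewrite vB inE => /esym/eqP.
  - exact: NP.
case/card_gt1P => u1 [u2 [u1N u2N u12]].
pose N' u y := if y == x then N x :\ u else N y.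
have N'sub u y : N' u y \subset N y.
  by rewrite /N'; case: eqP => [->|//]; rewrite subD1set.
have reduce u : u \in N x ->
    (forall A : {set T}, #|A| <= #|\bigcup_(y in A) N' u y| + d)%N ->
    exists (B : {set U}) (g : U -> T),
    [/\ {in B &, injective g}, forall u, u \in B -> u \in N (g u)
      & (#|T| <= #|B| + d)%N].
  move=> uN /IH; case=> [|B [g [gi gB cB]]]; last first.
    by exists B, g; split=> // v /gB; apply/fintype.subsetP/N'sub.
  move: lt_m; rewrite ltnS; apply: leq_trans.
  rewrite (bigD1 x) //= [X in (_ < X)%N](bigD1 x) //= {1}/N' eqxx.
  rewrite (cardsD1 u (N x)) uN add1n addSn ltnS leq_add2l.
  by apply: leq_sum => y _; exact: subset_leq_card.
have tight u : (forall A : {set T}, #|A| <= #|\bigcup_(y in A) N' u y| + d)%N \/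
    exists2 A : {set T}, x \in A & (#|\bigcup_(y in A) N' u y| + d < #|A|)%N.
  have [/forallP|/forallPn[A]] :=
    boolP [forall A : {set T}, #|A| <= #|\bigcup_(y in A) N' u y| + d]%N.
    by left.
  rewrite -ltnNge => ltA; right; exists A => //; apply: contraLR ltA => xA.
  rewrite -leqNgt (eq_bigr N) // => y yA; rewrite /N'; case: eqP => // yx.
  by rewrite -yx yA in xA.
have [/(reduce _ u1N)//|[A1 xA1 lt1]] := tight u1.
have [/(reduce _ u2N)//|[A2 xA2 lt2]] := tight u2.
set P1 := \bigcup_(y in A1) _ in lt1; set P2 := \bigcup_(y in A2) _ in lt2.
(* As [u1] and [u2] differ, each element of [N x] survives one of the two deletions. *)
have leU : (#|A1 :|: A2| <= #|P1 :|: P2| + d)%N.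
  apply: leq_trans (hN _) _; rewrite leq_add2r subset_leq_card //.
  apply/bigcupsP => y yA; apply/fintype.subsetP => u uN.
  have [yx|yx] := eqVneq y x.
    rewrite inE; have [uu1|uu1] := eqVneq u u1; apply/orP; [right|left];
      apply/bigcupP; exists x => //; rewrite /N' eqxx in_setD1 -yx uN andbT //.
    by rewrite uu1.
  move: yA; rewrite !inE => /orP[] yA; apply/orP; [left|right];
    apply/bigcupP; exists y => //; by rewrite /N' (negPf yx).
have leI : (#|(A1 :&: A2) :\ x| <= #|P1 :&: P2| + d)%N.
  apply: leq_trans (hN _) _; rewrite leq_add2r subset_leq_card //.
  apply/bigcupsP => y; rewrite !inE => /and3P[yx y1 y2].
  by rewrite finset.subsetI; apply/andP; split; apply: (finset.bigcup_max y) => //;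
    rewrite /N' (negPf yx).
have xI : x \in A1 :&: A2 by rewrite inE xA1.
(* [lt1] and [lt2] together exceed the Hall bounds by two, while [leU], [leI] and the extra vertex
   [x] allow an excess of only one. *)
have := cardsUI A1 A2; have := cardsUI P1 P2; have := cardsD1 x (A1 :&: A2).
rewrite xI; lia.
Qed.

(** * Largest root of a polynomial *)

Lemma max_root {R : realFieldType} (p : {poly R}) (a : R) : p != 0 -> root p a ->
  exists2 b, root p b & forall c, root p c -> c <= b.
Proof.
have [m] := ubnP (size p); elim: m p a => // m IH p a lt_m p0 pa.
have /factor_theorem[q def_p] := pa.
have q0 : q != 0 by apply: contraNneq p0 => q0; rewrite def_p q0 mul0r.
have rp c : root p c = root q c || (c == a).
  by rewrite def_p rootM root_XsubC.
have [[c qc]|noq] := pselect (exists c, root q c); last first.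
  by exists a => // c; rewrite rp => /orP[qc|/eqP->//]; case: noq; exists c.
have sq : (size q < m)%N.
  by move: lt_m; rewrite def_p size_Mmonic ?monicXsubC // size_XsubC addn2.
have [b qb bmax] := IH q c sq q0 qc.
exists (Num.max a b); first by rewrite rp /Num.max; case: ifP; rewrite ?qb ?eqxx ?orbT.
by move=> e; rewrite rp le_max => /orP[/bmax->|/eqP->]; rewrite ?lexx ?orbT.
Qed.

(** * Fractional matchings from partial injections *)

Lemma sum_const_half {R : realType} (T : finType) (P : pred T) :
  \sum_(u | P u) (2^-1 : R) = #|[set u | P u]|%:R / 2.
Proof. by rewrite -sum1dep_card natr_sum mulr_suml; under eq_bigr do rewrite -[2^-1]mul1r. Qed.

(** Each [u] in [B] puts weight 1/2 on the edge [[set u; g u]]; at a vertex [v] only [u = v] and the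
    at most one [u] with [g u = v] contribute. *)
Lemma fractional_matching_number_ge {R : realType} (G : sgraph) (B : {set G})
    (g : G -> G) : {in B &, injective g} -> (forall u, u \in B -> adj u (g u)) ->
  #|B|%:R / 2 <= fractional_matching_number G R.
Proof.
move=> g_inj g_adj.
(* The sum gives weight 1 to an edge chosen from both of its ends. *)
pose f (e : {set G}) : R := \sum_(u in B | [set u; g u] == e) 2^-1.
have f_ge0 e : 0 <= f e by apply: sumr_ge0 => u _; rewrite invr_ge0 ler0n.
have gE u : u \in B -> [set u; g u] \in edges G.
  by move=> uB; apply/imsetP; exists (u, g u); rewrite // inE /= g_adj.
have f_vertex v : \sum_(e in edges G | v \in e) f e <= 1.
  suff -> : \sum_(e in edges G | v \in e) f e =
      \sum_(u | (u \in B) && (v \in [set u; g u])) 2^-1.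
    rewrite sum_const_half ler_pdivrMr ?ltr0n // mul1r ler_nat.
    have sub : [set u | (u \in B) && (v \in [set u; g u])]
        \subset [set v] :|: [set u in B | g u == v].
      apply/fintype.subsetP => u; rewrite !inE [u == v]eq_sym [g u == v]eq_sym.
      by case/andP => ->.
    apply: leq_trans (subset_leq_card sub) _.
    apply: leq_trans (leq_card_setU _ _) _; rewrite cards1 add1n ltnS.
    apply/card_le1_eqP => u w; rewrite !inE => /andP[uB /eqP gu] /andP[wB /eqP gw].
    by apply: g_inj; rewrite // gu gw.
  rewrite (partition_big (fun u => [set u; g u])
    (fun e => (e \in edges G) && (v \in e))) => [|u /andP[uB ->]]; last by rewrite gE.
  apply: eq_bigr => e /andP[_ ve]; apply: eq_bigl => u.
  by case: eqP => [->|]; rewrite ?andbF // ve !andbT.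
have f_sum : \sum_(e in edges G) f e = #|B|%:R / 2.
  have <- : #|[set u | u \in B]| = #|B| by rewrite cardsE.
  rewrite -sum_const_half.
  by rewrite (partition_big (fun u => [set u; g u]) (mem (edges G))).
rewrite -f_sum; apply: ub_le_sup; last first.
  exists f => //; split=> // e eE; rewrite f_ge0 /=.
  have /imsetP[[x y] _ def_e] := eE.
  apply: le_trans (f_vertex x); rewrite (bigD1 e) /=; last first.
    by rewrite eE def_e !inE eqxx.
  by rewrite lerDl sumr_ge0.
exists #|edges G|%:R => _ [h [h01 _] <-].
rewrite -sum1_card natr_sum ler_sum // => e /h01 /andP[_ h1].
by [].
Qed.

(* A maximum matching of the bipartite double cover of [G], each edge weighted
   one half, is a fractional matching of [G]. *)
Lemma fractional_matching_deficiency {R : realType} (G : sgraph) (k : nat) :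
    (0 < k <= #|G|)%N ->
    fractional_matching_number G R <= (#|G|%:R - k%:R) / 2 ->
  exists S I : {set G}, [/\ forall u v, u \in I -> adj u v -> v \in S,
    [disjoint S & I] & #|I| = (#|S| + k)%N].
Proof.
move=> /andP[k0 kG] mu_le; pose N (x : G) := [set y | adj x y].
have [x0] : exists x : G, x \in G by apply/card_gt0P; apply: leq_trans kG.
move=> _.
(* Deficiency [k.-1] would give a fractional matching of weight at least [(#|G| - k + 1) / 2], so
   some [A] exceeds its neighbourhood by at least [k]. *)
have [/forallP hN|/forallPn[A]] :=
    boolP [forall A : {set G}, #|A| <= #|\bigcup_(x in A) N x| + k.-1]%N.
  have [B [g [gi gB cB]]] := @hall_deficiency G G x0 k.-1 N hN.
  have gB' u : u \in B -> adj u (g u) by move/gB; rewrite inE adj_sym.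
  have := le_trans (fractional_matching_number_ge _ _ _ gi gB') mu_le.
  rewrite ler_pM2r ?invr_gt0 ?ltr0n // lerBrDr -natrD ler_nat.
  by move: cB k0; lia.
set NA := \bigcup_(x in A) _; rewrite -ltnNge => ltA.
have NAP u v : u \in A -> adj u v -> v \in NA.
  by move=> uA uv; apply/bigcupP; exists u; rewrite ?inE.
(* Dropping the common part [A :&: NA] keeps the gap and leaves in [A :\: NA] only vertices without
   neighbours in [A]. A subset of exact size is then cut out of it. *)
have le : (#|NA :\: A| + k <= #|A :\: NA|)%N.
  by have := cardsID A NA; have := cardsID NA A; rewrite finset.setIC; lia.
have /card_geqP[s [us sz sub]] := le.
exists (NA :\: A), [set u in s]; split.
- move=> u v; rewrite !inE => /sub; rewrite !inE => /andP[uN uA] uv.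
  rewrite (NAP u) // andbT; apply: contra uN => vA.
  by apply: (NAP v) => //; rewrite adj_sym.
- rewrite disjoint_subset; apply/fintype.subsetP => u; rewrite !inE => /andP[uA _].
  by apply: contra uA => /sub; rewrite inE => /andP[].
- by rewrite -sz cardsE; apply/card_uniqP.
Qed.

(** * Eigenvalues, spectral radius and supersolutions *)

(** Row eigenvectors become functions on vertices; the symmetry of [adj] turns column sums into
    neighbour sums. *)
Lemma eigenvalue_adjacencyP {R : realType} (G : sgraph) (a : R) :
  eigenvalue (adjacency_matrix G R) a <->
  exists2 x : G -> R, forall v, \sum_(u | adj v u) x u = a * x v
                    & exists v, x v != 0.
Proof.
have mulE (x : G -> R) v :
    ((\row_i x (enum_val i)) *m adjacency_matrix G R) 0 (enum_rank v) =
    \sum_(u | adj v u) x u.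
  rewrite mxE (reindex_onto enum_rank enum_val) /=; last by move=> i _; rewrite enum_valK.
  rewrite [RHS]big_mkcond /=; apply: eq_big => [u|u _]; first by rewrite enum_rankK eqxx.
  by rewrite !mxE !enum_rankK adj_sym; case: ifP; rewrite ?mulr1 ?mulr0.
split=> [/eigenvalueP[y yA y0]|[x xA [v xv]]].
  exists (fun u => y 0 (enum_rank u)) => [v|].
    rewrite -mulE (_ : \row_i _ = y) ?yA ?mxE //.
    by apply/rowP => i; rewrite mxE enum_valK.
  have /rV0Pn[i yi] := y0.
  by exists (enum_val i); rewrite enum_valK.
apply/eigenvalueP; exists (\row_i x (enum_val i)).
  by apply/rowP => i; rewrite -(enum_valK i) mulE xA !mxE enum_rankK.
by apply/rV0Pn; exists (enum_rank v); rewrite mxE enum_rankK.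
Qed.

Lemma spectral_radius_ge {R : realType} (G : sgraph) (a : R) :
  eigenvalue (adjacency_matrix G R) a -> a <= spectral_radius G R.
Proof.
move=> aE; apply: ub_le_sup => //.
have p0 : char_poly (adjacency_matrix G R) != 0 by rewrite monic_neq0 ?char_poly_monic.
have := aE; rewrite eigenvalue_root_char => /(max_root _ _ p0)[b _ bmax].
by exists b => c; rewrite /mkset eigenvalue_root_char => /bmax.
Qed.

(* The supremum of an empty spectrum would be [0], so a positive lower bound
   already forces an eigenvalue to exist. *)
Lemma spectral_radius_attained {R : realType} (G : sgraph) (r : R) :
  0 < r -> r <= spectral_radius G R ->
  exists2 a, eigenvalue (adjacency_matrix G R) a & r <= a.
Proof.
move=> r0 r_le.
have [[a aE]|noE] := pselect (exists a, eigenvalue (adjacency_matrix G R) a); last first.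
  suff E0 : spectral_radius G R = 0 by move: r_le; rewrite E0 leNgt r0.
  rewrite /spectral_radius (_ : [set _ | _]%classic = set0) ?sup0 //.
  by apply/seteqP; split=> // a aE; case: noE; exists a.
have p0 : char_poly (adjacency_matrix G R) != 0 by rewrite monic_neq0 ?char_poly_monic.
have := aE; rewrite eigenvalue_root_char => /(max_root _ _ p0)[b bE bmax].
exists b; first by rewrite eigenvalue_root_char.
apply: le_trans r_le _; apply: ge_sup; first by exists a.
by move=> c; rewrite /mkset eigenvalue_root_char => /bmax.
Qed.

Lemma adj_sum_sym {R : realType} (G : sgraph) (y z : G -> R) :
  \sum_v y v * (\sum_(u | adj v u) z u) = \sum_v z v * (\sum_(u | adj v u) y u).
Proof.
under eq_bigr do rewrite mulr_sumr; under [RHS]eq_bigr do rewrite mulr_sumr.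
rewrite (exchange_big_dep predT) //=; apply: eq_bigr => u _.
by apply: eq_big => [v|v _]; [exact: adj_sym | rewrite mulrC].
Qed.

(* [z] is the modulus of an eigenvector.  Pairing [A z >= r z] with
   [A y <= r y] through the symmetry of [A] forces equality in both, wherever
   the other vector is positive. *)
Lemma supersolution_equality {R : realType} (G : sgraph) (r : R) (y : G -> R) :
    (forall v, 0 < y v) -> (forall v, \sum_(u | adj v u) y u <= r * y v) ->
    0 < r -> r <= spectral_radius G R ->
  exists z : G -> R, [/\ forall v, 0 <= z v, exists v, 0 < z v,
    forall v, \sum_(u | adj v u) z u = r * z v
    & forall v, 0 < z v -> \sum_(u | adj v u) y u = r * y v].
Proof.
move=> y0 Ay r0 /(spectral_radius_attained _ _ r0)[a /eigenvalue_adjacencyP].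
move=> [x xA [v0 xv0]] ra; exists (fun v => `|x v|).
have Az v : r * `|x v| <= \sum_(u | adj v u) `|x u|.
  apply: le_trans (ler_norm_sum _ _ _); rewrite xA normrM ler_wpM2r //.
  by rewrite (le_trans ra) // ler_norm.
pose p v := y v * (\sum_(u | adj v u) `|x u| - r * `|x v|).
pose q v := `|x v| * (r * y v - \sum_(u | adj v u) y u).
have p0 v : 0 <= p v by rewrite mulr_ge0 ?subr_ge0 // ltW.
have q0 v : 0 <= q v by rewrite mulr_ge0 ?subr_ge0.
have pq : \sum_v (p v + q v) = 0.
  rewrite (eq_bigr (fun v => y v * (\sum_(u | adj v u) `|x u|)
    - `|x v| * (\sum_(u | adj v u) y u))); last by move=> v _; rewrite /p /q; ring.
  by rewrite sumrB adj_sum_sym subrr.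
have pq0 v : p v + q v = 0 by apply: (psumr_eq0P _ pq) => // u _; rewrite addr_ge0.
have /all_and2[pz qz] : forall v, p v = 0 /\ q v = 0.
  by move=> v; move: (pq0 v) (p0 v) (q0 v); lra.
split=> // [|v|v zv]; first by exists v0; rewrite normr_gt0.
- have /eqP := pz v; rewrite mulf_eq0 gt_eqF //= subr_eq0; exact: eqP.
- by have /eqP := qz v; rewrite mulf_eq0 gt_eqF //= subr_eq0 => /eqP.
Qed.

(** * Graphs determined by three vertex classes *)

(* Vertex classes of [K_s \/ (K_m + p K_1)]: [None] is the joined clique [K_s],
   [Some true] is [K_m] and [Some false] is [p K_1]. *)
Definition block_rel (c d : option bool) : bool :=
  if c is Some b then (if d is Some b' then b && b' else true) else true.

Lemma block_relC c d : block_rel c d = block_rel d c.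
Proof. by case: c d => [[]|] [[]|]. Qed.

(** The cases are the rows of the quotient matrix; in a clique class the own weight of [v] is taken
    off. *)
Lemma block_sum {R : realType} (T : finType) (c : T -> option bool)
    (w : option bool -> R) (v : T) (t := fun j => #|[set u | c u == j]|%:R * w j) :
  \sum_(u | (v != u) && block_rel (c v) (c u)) w (c u) =
  match c v with
  | None => t None + t (Some true) + t (Some false) - w None
  | Some true => t None + t (Some true) - w (Some true)
  | Some false => t None
  end.
Proof.
have tE j : \sum_(u | c u == j) w (c u) = t j.
  rewrite (eq_bigr (fun _ => w j)) => [|u /eqP->//].
  by rewrite big_const iter_addr_0 /t mulr_natl cardsE.
have all_u : \sum_(u | block_rel (c v) (c u)) w (c u) =
    \sum_(j | block_rel (c v) j) t j.
  rewrite (partition_big c (block_rel (c v))) //=; apply: eq_bigr => j vj.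
  by rewrite -tE; apply: eq_bigl => u; case: eqP => [->|]; rewrite ?andbF ?vj.
have optE (P : pred (option bool)) : \sum_(j | P j) t j =
    (if P None then t None else 0) + (if P (Some true) then t (Some true) else 0)
    + (if P (Some false) then t (Some false) else 0).
  rewrite big_mkcond (bigD1 None) //= (bigD1 (Some true)) //= (bigD1 (Some false)) //=.
  by rewrite big1 ?addr0 ?addrA // => -[[]|].
move: all_u; rewrite optE.
have [vv|vv] := boolP (block_rel (c v) (c v)).
  rewrite (bigD1 v) //= (eq_bigl (fun u => (v != u) && block_rel (c v) (c u)));
    last by move=> u; rewrite andbC eq_sym.
  by move: vv; case: (c v) => [[]|] //= _; lra.
rewrite (eq_bigl (fun u => (v != u) && block_rel (c v) (c u))); last first.
  by move=> u; have [<-|//] := eqVneq v u; rewrite (negPf vv).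
by move: vv; case: (c v) => [[]|] //= _; lra.
Qed.

(** The i-th vertex of a class goes to the i-th vertex of the same class of [H]; [y0] is only the
    default of [nth]. *)
Lemma block_iso (G H : sgraph) (y0 : H) (c : G -> option bool) (d : H -> option bool) :
    (forall x y : G, adj x y = (x != y) && block_rel (c x) (c y)) ->
    (forall x y : H, adj x y = (x != y) && block_rel (d x) (d y)) ->
    (forall j, #|[set x | c x == j]| = #|[set y | d y == j]|) ->
  graph_iso G H.
Proof.
move=> adjG adjH card_cd.
pose sG j := enum [set x | c x == j]; pose sH j := enum [set y | d y == j].
have s_sz j : size (sG j) = size (sH j) by rewrite -!cardE.
pose f x := nth y0 (sH (c x)) (index x (sG (c x))).
have ltx x : (index x (sG (c x)) < size (sH (c x)))%N.
  by rewrite -s_sz index_mem mem_enum inE.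
have df x : d (f x) = c x.
  by have := mem_nth y0 (ltx x); rewrite mem_enum inE => /eqP.
have f_inj : injective f.
  move=> x y fxy; have cxy : c x = c y by rewrite -!df fxy.
  have lty := ltx y; move: fxy; rewrite /f -cxy in lty * => /eqP.
  rewrite nth_uniq ?enum_uniq // => /eqP eq_ix.
  have xs : x \in sG (c x) by rewrite mem_enum inE.
  have ys : y \in sG (c x) by rewrite mem_enum inE cxy.
  by rewrite -(nth_index x xs) eq_ix nth_index.
have card_GH : #|G| = #|H|.
  rewrite -!sum1_card (partition_big c predT) //= [RHS](partition_big d predT) //=.
  by apply: eq_bigr => j _; have := card_cd j; rewrite -!sum1dep_card.
exists f; first by apply: inj_card_bij; rewrite ?card_GH.
by move=> x y; rewrite adjH adjG !df (inj_eq f_inj).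
Qed.

Definition extremal_class (n delta k : nat) (x : extremal_graph n delta k) : option bool :=
  match x with
  | inl _ => None
  | inr (inl _) => Some true
  | inr (inr _) => Some false
  end.

Lemma extremal_adj n delta k (x y : extremal_graph n delta k) :
  adj x y = (x != y) && block_rel (extremal_class _ _ _ x) (extremal_class _ _ _ y).
Proof.
by case: x y => [x|[x|x]] [y|[y|y]]; rewrite /= ?andbT ?andbF.
Qed.

Lemma card_extremal_class n delta k j :
  #|[set x | extremal_class n delta k x == j]| =
  match j with
  | None => delta
  | Some true => (n - 2 * delta - k)%N
  | Some false => (delta + k)%N
  end.
Proof.
rewrite -sum1dep_card big_mkcond big_sumType /= big_sumType /= .
case: j => [[]|]; rewrite ?sum1_card ?card_ord ?big1 ?addn0 //.
Qed.

(** * The cubic of [H_s] and its largest root *)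

(** Characteristic polynomial of the quotient matrix with rows (s-1, m, s+K), (s, m-1, 0), (s, 0,
    0), where m = N-2s-K. *)
Definition block_cubic {R : realType} (N K s x : R) : R :=
  x * (x + 1) * (x + 1 - (N - s - K)) - s * (s + K) * (x + 1 - (N - 2 * s - K)).

(** The factor [q] grows with [r] from [r0] on and, at [r0], decreases in [s]; so it is bounded
    below by its value at the least [r] and the largest [s], namely [r0] and [s1]. *)
Lemma block_cubic_gt0 {R : realType} (N K D s r : R) :
    0 <= D -> 1 <= K -> D < s -> 2 * s + K <= N -> 6 * D + 5 * K + 1 <= N ->
    N - D - K - 1 <= r -> block_cubic N K D r = 0 ->
  0 < block_cubic N K s r.
Proof.
move=> D0 K1 Ds sN nN rN cD.
pose q t x := x * (x + 1) - (t + D + K) * (x + 1 - N + K)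
  - 2 * (t ^+ 2 + t * D + D ^+ 2 + K * (t + D)).
have -> : block_cubic N K s r = (s - D) * q s r.
  by rewrite -[LHS]subr0 -cD /block_cubic /q; ring.
apply: mulr_gt0; first by rewrite subr_gt0.
pose r0 := N - D - K - 1; pose s1 := (N - K) / 2.
have q1 : 0 < q s1 r0.
  have -> : q s1 r0 = s1 * (N - K - 5 * D - 2 * K - 2) - D * K + D.
    by rewrite /q /s1 /r0; field.
  (* The lower bound on [N] makes the last factor at least [D + 2 * K - 1], hence at least [K]. *)
  have : s1 * K <= s1 * (N - K - 5 * D - 2 * K - 2) by apply: ler_wpM2l; rewrite /s1; lra.
  have : D * K < s1 * K by rewrite ltr_pM2r /s1; lra.
  lra.
have q2 : q s1 r0 <= q s r0.
  rewrite -subr_ge0 (_ : _ - _ = (s1 - s) * (2 * (s1 + s) + D + 2 * K)).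
    by apply: mulr_ge0; rewrite /s1; lra.
  by rewrite /q /r0; ring.
apply: lt_le_trans q1 (le_trans q2 _).
rewrite -subr_ge0 (_ : _ - _ = (r - r0) * (r + r0 + 1 - (s + D + K))).
  by apply: mulr_ge0; rewrite /r0; lra.
by rewrite /q; ring.
Qed.

Lemma block_cubic_root {R : realType} (N K D : R) :
    0 <= D -> 1 <= K -> 6 * D + 5 * K + 1 <= N ->
  exists2 r, N - D - K - 1 <= r & block_cubic N K D r = 0.
Proof.
move=> D0 K1 nN.
pose p : {poly R} := 'X * ('X + 1) * ('X + 1 - (N - D - K)%:P)
  - (D * (D + K))%:P * ('X + 1 - (N - 2 * D - K)%:P).
have pE x : p.[x] = block_cubic N K D x by rewrite /p /block_cubic !hornerE.
(* The left end is the spectral radius of the clique formed by the first two classes, where the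
   leading product vanishes; [N - 1] bounds every spectral radius of a graph of order N. *)
have [||r /andP[r1 _]] := @poly_ivt R p (N - D - K - 1) (N - 1).
- lra.
- rewrite !pE /block_cubic; apply/andP; split.
    rewrite (_ : _ - _ = - (D * (D + K) * D)); last by ring.
    by rewrite oppr_le0 !mulr_ge0 //; lra.
  rewrite (_ : _ - _ = (D + K) * ((N - 1) * N - D * (2 * D + K))); last by ring.
  apply: mulr_ge0; first lra.
  rewrite subr_ge0; apply: ler_pM; lra.
- by rewrite /root pE => /eqP; exists r.
Qed.

(** Eigenvector of the quotient matrix with denominators cleared: the last two rows hold for every
    [r], and the row of [None] fails by exactly [block_cubic]. *)
Definition block_weight {R : realType} (s m r : R) (j : option bool) : R :=
  match j with
  | None => r * (r + 1 - m)
  | Some true => s * r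
  | Some false => s * (r + 1 - m)
  end.

Lemma extremal_spectral_radius_ge {R : realType} (n delta k : nat) (r : R) :
    (6 * delta + 5 * k + 1 <= n)%N -> n%:R - delta%:R - k%:R - 1 <= r ->
    block_cubic n%:R k%:R delta%:R r = 0 ->
  r <= spectral_radius (extremal_graph n delta k) R.
Proof.
move=> n_large r_ge cr.
set m : R := (n - 2 * delta - k)%:R.
have mE : m = n%:R - 2 * delta%:R - k%:R by rewrite /m !natrB ?natrM //; lia.
have nR : 6 * delta%:R + 5 * k%:R + 1 <= n%:R :> R.
  by have := n_large; rewrite -(ler_nat R) !natrD; lra.
have d0 : 0 <= delta%:R :> R by [].
have k0 : 0 <= k%:R :> R by [].
(* For [delta = 0] the class [None] is empty and [block_weight] vanishes on the others, so the
   indicator of the clique replaces it. *)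
pose w := if delta == 0%N then fun j => (j == Some true)%:R
          else block_weight delta%:R m r.
have r0 : 0 <= r by apply: le_trans r_ge; lra.
apply: spectral_radius_ge; apply/eigenvalue_adjacencyP.
exists (fun v => w (extremal_class _ _ _ v)).
  move=> v; under eq_bigl do rewrite extremal_adj.
  rewrite block_sum !card_extremal_class -/m /w.
  have [d00|dn0] := eqVneq delta 0%N.
    have dR : delta%:R = 0 :> R by rewrite d00.
    move: cr r_ge nR; rewrite /block_cubic mE dR => cr r_ge nR.
    (* Here the cubic splits, and [r > 0] leaves only the eigenvalue [n - k - 1] of the clique. *)
    have rm : r + 1 = n%:R - k%:R \/ r * (r + 1) = 0.
      have /eqP : r * (r + 1) * (r + 1 - (n%:R - k%:R)) = 0 by rewrite -[RHS]cr; ring.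
      rewrite mulf_eq0 => /orP[/eqP|/eqP]; [by right | left; lra].
    have {}rm : r + 1 = n%:R - k%:R.
      case: rm => // /eqP; rewrite mulf_eq0 => /orP[]/eqP r00; lra.
    case: v => [x|[x|x]] /=; last by lra.
      by have := leq_ltn_trans (leq0n x) (ltn_ord x); rewrite d00.
    by rewrite mulr0 mulr1; lra.
  case: v => [x|[x|x]] /=; rewrite ?natrD mE; last by ring.
    apply/eqP; rewrite -subr_eq0 -oppr_eq0 -[X in _ == X]cr /block_cubic; apply/eqP; ring.
  by ring.
have m_gt0 : (0 < n - 2 * delta - k)%N by lia.
exists (inr (inl (Ordinal m_gt0))); rewrite /w /=.
have [_|dn0] := eqVneq delta 0%N; first by rewrite oner_eq0.
have d1 : 1 <= delta%:R :> R by rewrite ler1n lt0n.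
by rewrite mulf_neq0 ?gt_eqF //; lra.
Qed.

(** * Equality case for spanning subgraphs of [H_s] *)

Lemma min_degree_le (G : sgraph) (v : G) : (min_degree G <= degree v)%N.
Proof.
rewrite /min_degree; have : v \in index_enum G by exact: mem_index_enum.
elim: (index_enum G) => // u s IH; rewrite inE big_cons geq_min.
by case/orP => [/eqP<-|/IH->]; rewrite ?leqnn ?orbT.
Qed.

(* The weights of a Perron vector of [K_s \/ (K_m + (s + k) K_1)] with [r] in
   place of its spectral radius form a positive supersolution on [G]; equality
   on the support of an eigenvector then determines [G]. *)
Lemma block_subgraph_extremal {R : realType} (G : sgraph) (n delta k s : nat) (r : R)
    (c : G -> option bool) :
    (0 < k)%N -> (6 * delta + 5 * k + 1 <= n)%N -> (delta <= s)%N ->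
    (2 * s + k <= n)%N ->
    n%:R - delta%:R - k%:R - 1 <= r -> block_cubic n%:R k%:R delta%:R r = 0 ->
    r <= spectral_radius G R ->
    (forall x y : G, adj x y -> block_rel (c x) (c y)) ->
    (forall j, #|[set x | c x == j]| = match j with
      | None => s | Some true => (n - 2 * s - k)%N | Some false => (s + k)%N end) ->
  s = delta /\ forall x y : G, adj x y = (x != y) && block_rel (c x) (c y).
Proof.
move=> k_gt0 n_large le_ds sn r_ge cr r_le adj_c card_c.
set m : R := (n - 2 * s - k)%:R.
have mE : m = n%:R - 2 * s%:R - k%:R by rewrite /m !natrB ?natrM //; lia.
have nR : 6 * delta%:R + 5 * k%:R + 1 <= n%:R :> R.
  by have := n_large; rewrite -(ler_nat R) !natrD; lra.
have snR : 2 * s%:R + k%:R <= n%:R :> R by have := sn; rewrite -(ler_nat R) !natrD; lra.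
have d0 : 0 <= delta%:R :> R by [].
have k1 : 1 <= k%:R :> R by rewrite ler1n.
have dsR : delta%:R <= s%:R :> R by rewrite ler_nat.
have r0 : 0 < r by apply: lt_le_trans r_ge; lra.
have no_joined v : s = 0%N -> c v <> None.
  move=> s0 cv; have := card_c None; rewrite s0 => /eqP; rewrite cards_eq0.
  by move=> /eqP/setP/(_ v); rewrite !inE cv eqxx.
(* [block_weight] is not positive for [s = 0]; the constant 1 then serves. *)
pose w := if s == 0%N then fun=> 1 else block_weight s%:R m r.
have w0 j : 0 < w j.
  rewrite /w; have [//|s0] := eqVneq s 0%N.
  have s1 : 1 <= s%:R :> R by rewrite ler1n lt0n.
  by case: j => [[]|] /=; rewrite mulr_gt0 //; lra.
(* Neighbour sums in [H_s]: they dominate those in [G], and [BE] gives their slack. *)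
pose B v := \sum_(u | (v != u) && block_rel (c v) (c u)) w (c u).
have BE v : r * w (c v) - B v = if s == 0%N then
    (if c v == Some true then r - m + 1 else r)
  else if c v == None then block_cubic n%:R k%:R s%:R r else 0.
  rewrite /B block_sum !card_c -/m /w /=; have [s0|s0] := eqVneq s 0%N.
    by have := no_joined v s0; case: (c v) => [[]|] //= _; rewrite s0; ring.
  by case: (c v) => [[]|] /=; rewrite ?natrD mE /block_cubic; ring.
have cubic_gt0 : (delta < s)%N -> 0 < block_cubic n%:R k%:R s%:R r.
  by move=> lt_ds; apply: (block_cubic_gt0 _ _ delta%:R); rewrite ?ltr_nat.
have B_le v : B v <= r * w (c v).
  rewrite -subr_ge0 BE; case: ifP => [/eqP s0|_].
    by case: ifP => _; [move: mE dsR; rewrite s0; lra | exact: ltW].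
  case: ifP => // _; move: le_ds; rewrite leq_eqVlt => /orP[/eqP<-|/cubic_gt0/ltW//].
  by rewrite cr.
have BA v : B v = \sum_(u | adj v u) w (c u)
    + \sum_(u | [&& v != u, block_rel (c v) (c u) & ~~ adj v u]) w (c u).
  rewrite /B (bigID (adj v)) /=; congr (_ + _); apply: eq_bigl => u; last by rewrite andbA.
  case vu : (adj v u); rewrite ?andbF // (adj_c _ _ vu) !andbT.
  by apply/eqP => uv; move: vu; rewrite uv adj_irr.
have A_le v : \sum_(u | adj v u) w (c u) <= r * w (c v).
  by apply: le_trans (B_le v); rewrite BA lerDl sumr_ge0 // => u _; apply: ltW.
have [z [z0 [v0 zv0] Az Aw]] := supersolution_equality _ _ _ (fun v => w0 (c v)) A_le r0 r_le.
(* The support of [z] is closed under adjacency, since [r * z u] is a sum containing [z v]. *)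
have closed v u : 0 < z v -> adj v u -> 0 < z u.
  move=> zv vu; rewrite -(pmulr_rgt0 _ r0) -Az (bigD1 v) /=; last by rewrite adj_sym.
  by rewrite ltr_pwDl // sumr_ge0.
(* A missing edge at a support vertex would add a positive weight and push [B v] above
   [r * w (c v)]. *)
have full v u : 0 < z v -> v != u -> block_rel (c v) (c u) -> adj v u.
  move=> zv vu cvu; apply/negPn/negP => nvu.
  have := B_le v; rewrite BA Aw // gerDl leNgt => /negP; apply.
  rewrite (bigD1 u) /=; last by rewrite vu cvu nvu.
  by rewrite ltr_pwDl // sumr_ge0 // => x _; apply: ltW.
have B_eq v : 0 < z v -> B v = r * w (c v).
  by move=> zv; apply/eqP; rewrite eq_le B_le -(Aw _ zv) BA lerDl sumr_ge0 // => u _; apply: ltW.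
suff [sd pos] : s = delta /\ forall x y, x != y -> block_rel (c x) (c y) -> 0 < z x.
  split=> // x y; apply/idP/andP => [xy|[xy cxy]].
    by split; [apply/eqP => exy; move: xy; rewrite exy adj_irr | exact: adj_c].
  by apply: full => //; apply: pos cxy.
have spread v u : 0 < z v -> block_rel (c v) (c u) -> 0 < z u.
  by have [->|vu zv cvu] := eqVneq v u; last exact: closed (full _ _ zv vu cvu).
have [s0|s0] := eqVneq s 0%N.
  split; first by move: le_ds; rewrite s0 leqn0 => /eqP.
  (* A vertex of class [Some false] would be isolated, forcing [r * z v0 = 0]. *)
  have cv0 : c v0 = Some true.
    have := no_joined v0 s0; case cv0 : (c v0) => [[]|] // _.
    have := Az v0; rewrite big_pred0 => [|u].
      by move/esym/eqP; rewrite mulf_eq0 !gt_eqF.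
    apply/negP => /adj_c; rewrite cv0; have := no_joined u s0.
    by case: (c u).
  move=> x y _ cxy; apply: (spread v0) => //; rewrite cv0.
  by move: cxy (no_joined x s0) (no_joined y s0); case: (c x) (c y) => [[]|] [[]|] //= _ _ [].
(* A joined vertex is related to every class, so [z] is positive everywhere. The slack at [v1] is
   then zero, but it equals the cubic of [s], which is positive if [delta < s]. *)
have [v1 cv1] : exists v1, c v1 = None.
  have : (0 < #|[set x | c x == None]|)%N by rewrite card_c lt0n.
  by case/card_gt0P => v1; rewrite inE => /eqP; exists v1.
have zv1 : 0 < z v1 by apply: (spread v0); rewrite // cv1 block_relC.
split; last by move=> x y _ _; apply: (spread v1); rewrite ?cv1.
apply/eqP; rewrite eqn_leq le_ds andbT leqNgt; apply/negP => /cubic_gt0.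
by have := BE v1; rewrite B_eq // subrr (negPf s0) cv1 eqxx => <-; rewrite ltxx.
Qed.

(** * From the deficient pair to the extremal graph *)

Theorem theorem1p3 (R : realType) (G : sgraph) (n delta k : nat)
    (card_G : #|G| = n)
    (min_degree_G : min_degree G = delta)
    (k_bounds : (0 < k < n)%N)
    (n_large : (maxn (6 * delta + 5 * k + 1)
                     (5 * delta + k ^ 2 + 4 * k + 1) <= n)%N)
    (rho_ge : spectral_radius G R >= spectral_radius (extremal_graph n delta k) R) :
  ~ graph_iso G (extremal_graph n delta k) ->
  fractional_matching_number G R > (n%:R - k%:R) / 2.
Proof.
move=> not_iso; rewrite ltNge; apply/negP => mu_le; apply: not_iso.
have {}n_large : (6 * delta + 5 * k + 1 <= n)%N by move: n_large; rewrite geq_max => /andP[].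
have [k_gt0 k_lt] := andP k_bounds.
have kG : (0 < k <= #|G|)%N by rewrite card_G k_gt0 ltnW.
rewrite -{1}card_G in mu_le.
have [S [I [adjI SI card_I]]] := fractional_matching_deficiency _ _ kG mu_le.
(* [S] is the joined clique, [I] the edgeless class, and all other vertices form the remaining
   clique. *)
pose c v : option bool := if v \in S then None else Some (v \notin I).
have adj_c x y : adj x y -> block_rel (c x) (c y).
  move=> xy; rewrite /c; case: ifP => // xS; case: ifP => //= yS.
  apply/andP; split; apply/negP; first by move=> /adjI/(_ xy); rewrite yS.
  by rewrite adj_sym in xy; move=> /adjI/(_ xy); rewrite xS.
have card_SI : (#|S :|: I| = 2 * #|S| + k)%N.
  have := cardsUI S I; move: SI; rewrite -setI_eq0 => /eqP ->.
  by rewrite cards0 card_I; lia.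
have le_n : (2 * #|S| + k <= n)%N by rewrite -card_SI -card_G max_card.
have card_c j : #|[set x | c x == j]| = match j with
    | None => #|S| | Some true => (n - 2 * #|S| - k)%N | Some false => (#|S| + k)%N end.
  case: j => [[]|].
  - rewrite -subnDA -card_SI -card_G -(cardsC (S :|: I)) addKn; apply: eq_card => x.
    by rewrite !inE /c; case: (x \in S) (x \in I) => [] [].
  - rewrite -card_I; apply: eq_card => x; rewrite !inE /c.
    by case: ifP => xS; [rewrite (disjointFr SI xS) | case: (x \in I)].
  - by apply: eq_card => x; rewrite !inE /c; case: (x \in S).
(* As [k > 0], [I] has a vertex, and all its neighbours lie in [S]. *)
have le_dS : (delta <= #|S|)%N.
  have /card_gt0P[i iI] : (0 < #|I|)%N by rewrite card_I addn_gt0 k_gt0 orbT.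
  rewrite -min_degree_G; apply: leq_trans (min_degree_le G i) _.
  by apply: subset_leq_card; apply/fintype.subsetP => u; rewrite inE => /adjI; apply.
have [|||r r_ge cr] := @block_cubic_root R n%:R k%:R delta%:R; rewrite ?ler1n //.
  by have := n_large; rewrite -(ler_nat R) !natrD; lra.
have r_le := le_trans (extremal_spectral_radius_ge _ _ _ _ n_large r_ge cr) rho_ge.
have [sd adjE] := block_subgraph_extremal _ _ _ _ _ _ c k_gt0 n_large le_dS le_n r_ge cr
  r_le adj_c card_c.
have m_gt0 : (0 < n - 2 * delta - k)%N by lia.
apply: (block_iso G (extremal_graph n delta k) (inr (inl (Ordinal m_gt0))) c
  (@extremal_class n delta k)) => //.
  exact: extremal_adj.
by move=> j; rewrite card_c card_extremal_class sd.
Qed.
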